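(* Let $f:\mathbb{R}^n\to\mathbb{R}^n$ be differentiable and suppose that the autonomous system $\frac{dy}{dt}=f(y)$ has a finite number of equilibria and that $\mathrm{Re}(\lambda)\neq 0$ for every $\lambda\in\Omega$, where $\Omega=\bigcup_{y^*\in\Gamma}\sigma(J(y^* ))$, $\Gamma$ is the set of all equilibria of the system, and $\sigma(J(y^* ))$ is the set of eigenvalues of the Jacobian matrix $J(y^* )$ of $f$ at $y^*$. Let $(A,b^T,h)$ be an $s$-stage explicit standard Runge-Kutta method whose order of accuracy $p$ satisfies $p<s$. Then there exists a number $\varphi^*=\varphi^*(p,\Omega,A,b^T,s)>0$, depending only on $p,\Omega,A,b^T,s$, such that the explicit nonstandard Runge-Kutta method $(A,b^T,\varphi)$ is elementary stable for the system whenever the denominator function $\varphi$ satisfies $$0<\varphi(h)<\varphi^*\qquad\text{for all } h>0.$$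
   Context: Let $s\ge 1$, let $A=(a_{ij})_{s\times s}$ be a real matrix with $a_{ij}=0$ for $j\ge i$, and let $b=(b_1,\ldots,b_s)\in\mathbb{R}^s$. Let $\varphi$ be a function of the step size $h>0$ with $\varphi(h)=h+\mathcal{O}(h^2)$ as $h\to 0$ (the denominator function). The explicit nonstandard Runge-Kutta (ENRK) method $(A,b^T,\varphi)$ for the system $\frac{dy}{dt}=f(y)$ with step size $h>0$ is the one-step scheme $$K_1=f(y_k),\quad K_i=f\Big(y_k+\varphi(h)\sum_{j=1}^{i-1}a_{ij}K_j\Big)\ (2\le i\le s),\qquad \frac{y_{k+1}-y_k}{\varphi(h)}=b_1K_1+\cdots+b_sK_s .$$ The choice $\varphi(h)=h$ gives the explicit standard Runge-Kutta (ESRK) method $(A,b^T,h)$. The order of accuracy of an ESRK method is its classical order: the method has order at least $p$ if for every sufficiently smooth $f$ the local error after one step starting from an exact value is $\mathcal{O}(h^{p+1})$ as $h\to0$; its order is the largest such $p$ (assumed $\ge 1$). An equilibrium of the system is a point $y^*$ with $f(y^* )=0$. An equilibrium $y^*$ of the system is linearly stable if all eigenvalues $\lambda$ of $J(y^* )$ satisfy $\mathrm{Re}(\lambda)<0$, and linearly unstable if some eigenvalue of $J(y^* )$ has $\mathrm{Re}(\lambda)>0$. Let $\hat J(y^* )$ be the Jacobian at $y^*$ of the map $y_k\mapsto y_{k+1}$ defined by the scheme. A fixed point $y^*$ of the scheme is linearly stable if all eigenvalues $\mu$ of $\hat J(y^* )$ satisfy $|\mu|<1$, and linearly unstable if some eigenvalue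 has $|\mu|>1$. The scheme is called elementary stable if it preserves the linear stability of the equilibria of the system for every step size: for every $h>0$, each equilibrium $y^*$ of the system is a fixed point of the scheme, and it is linearly stable (respectively linearly unstable) for the scheme if it is linearly stable (respectively linearly unstable) for the system. *)

(* Defs.v *)
From HB Require Import structures.
From mathcomp Require Import all_boot all_order all_algebra.
From mathcomp Require Import complex.
From mathcomp Require Import all_classical all_reals all_analysis.

Set Implicit Arguments.
Unset Strict Implicit.
Unset Printing Implicit Defensive.

Import Order.TTheory GRing.Theory Num.Theory.
Import numFieldNormedType.Exports.

Local Open Scope classical_set_scope.
Local Open Scope ring_scope.
Local Open Scope complex_scope.

Definition explicit_tableau (R : realType) (s : nat) (A : 'M[R]_s) : Prop :=
  forall i j : 'I_s, (i <= j)%N -> A i j = 0.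

Fixpoint rk_stage_iter (R : realType) (n s : nat) (A : 'M[R]_s)
    (f : 'rV[R]_n -> 'rV[R]_n) (e : R) (y : 'rV[R]_n) (m : nat) (i : 'I_s)
    : 'rV[R]_n :=
  if m is m'.+1 then
    f (y + e *: \sum_(j < s | (j < i)%N) A i j *: rk_stage_iter A f e y m' j)
  else 0.

(* The stage K_i (indexed from 0) with the number e in the role of the
   denominator function's value.  Only stages j < i enter K_i, so i.+1
   unfoldings determine it; rk_stageE is the defining recurrence. *)
Definition rk_stage (R : realType) (n s : nat) (A : 'M[R]_s)
    (f : 'rV[R]_n -> 'rV[R]_n) (e : R) (y : 'rV[R]_n) (i : 'I_s) : 'rV[R]_n :=
  rk_stage_iter A f e y i.+1 i.

Lemma rk_stageE (R : realType) (n s : nat) (A : 'M[R]_s)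
    (f : 'rV[R]_n -> 'rV[R]_n) (e : R) (y : 'rV[R]_n) (i : 'I_s) :
  rk_stage A f e y i =
  f (y + e *: \sum_(j < s | (j < i)%N) A i j *: rk_stage A f e y j).
Proof.
have indep m : forall (m' : nat) (k : 'I_s), (k < m)%N -> (k < m')%N ->
    rk_stage_iter A f e y m k = rk_stage_iter A f e y m' k.
  elim: m => [//|m IH] [//|m'] k km km' /=.
  congr (f (y + e *: _)); apply: eq_bigr => j jk; congr (_ *: _).
  by apply: IH; apply: leq_trans jk _.
rewrite {1}/rk_stage /=.
congr (f (y + e *: _)); apply: eq_bigr => j jk; congr (_ *: _).
exact: indep.
Qed.

Definition enrk (R : realType) (n s : nat) (A : 'M[R]_s) (b : 'rV[R]_s)
    (phi : R -> R) (f : 'rV[R]_n -> 'rV[R]_n) (h : R) (y : 'rV[R]_n)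
    : 'rV[R]_n :=
  y + phi h *: \sum_(i < s) b 0 i *: rk_stage A f (phi h) y i.

Definition esrk (R : realType) (n s : nat) (A : 'M[R]_s) (b : 'rV[R]_s)
    (f : 'rV[R]_n -> 'rV[R]_n) (h : R) (y : 'rV[R]_n) : 'rV[R]_n :=
  enrk A b id f h y.

Definition denominator_function (R : realType) (phi : R -> R) : Prop :=
  (fun h : R => phi h - h) =O_ (0^'+) (fun h : R => h ^+ 2).

Fixpoint Ck (R : realType) (n : nat) (k : nat) (f : 'rV[R]_n -> 'rV[R]_n)
    : Prop :=
  if k is k'.+1 then
    (forall x, differentiable f x) /\ (forall v, Ck k' ('D_v f))
  else continuous f.

Definition ode_solution (R : realType) (n : nat) (f : 'rV[R]_n -> 'rV[R]_n)
    (d : R) (y : R -> 'rV[R]_n) : Prop :=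
  forall t : R, - d < t < d -> is_derive t 1 y (f (y t)).

(* N is the smoothness required of the field: "sufficiently smooth".
   Systems of every dimension are tested: scalar equations alone do not
   detect all order conditions.  As the systems are autonomous, it suffices
   to start the step at time 0. *)
Definition order_at_least (R : realType) (s : nat) (A : 'M[R]_s)
    (b : 'rV[R]_s) (p : nat) : Prop :=
  exists N : nat, forall (n : nat) (f : 'rV[R]_n -> 'rV[R]_n), Ck N f ->
  forall (d : R) (y : R -> 'rV[R]_n), 0 < d -> ode_solution f d y ->
  (fun h : R => y h - esrk A b f h (y 0)) =O_ (0^'+) (fun h : R => h ^+ p.+1).

Definition order_of_accuracy (R : realType) (s : nat) (A : 'M[R]_s)
    (b : 'rV[R]_s) (p : nat) : Prop :=
  order_at_least A b p /\
  forall q : nat, order_at_least A b q -> (q <= p)%N.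

Definition equilibria (R : realType) (n : nat) (f : 'rV[R]_n -> 'rV[R]_n)
    : set 'rV[R]_n := [set y | f y = 0].

(* [jacobian] acts on row vectors (it is the transpose of the usual Jacobian
   matrix) and [eigenvalue] refers to row eigenvectors, so this is the usual
   complex spectrum. *)
Definition spectrum (R : realType) (n : nat) (F : 'rV[R]_n -> 'rV[R]_n)
    (y : 'rV[R]_n) : set R[i] :=
  [set l | eigenvalue (map_mx (real_complex R) (jacobian F y)) l].

Definition equilibria_spectrum (R : realType) (n : nat)
    (f : 'rV[R]_n -> 'rV[R]_n) : set R[i] :=
  \bigcup_(y in equilibria f) spectrum f y.

Definition ode_stable (R : realType) (n : nat) (f : 'rV[R]_n -> 'rV[R]_n)
    (y : 'rV[R]_n) : Prop :=
  forall l, spectrum f y l -> complex.Re l < 0.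

Definition ode_unstable (R : realType) (n : nat) (f : 'rV[R]_n -> 'rV[R]_n)
    (y : 'rV[R]_n) : Prop :=
  exists2 l, spectrum f y l & 0 < complex.Re l.

Definition map_stable (R : realType) (n : nat) (F : 'rV[R]_n -> 'rV[R]_n)
    (y : 'rV[R]_n) : Prop :=
  forall m, spectrum F y m -> `|m| < 1.

Definition map_unstable (R : realType) (n : nat) (F : 'rV[R]_n -> 'rV[R]_n)
    (y : 'rV[R]_n) : Prop :=
  exists2 m, spectrum F y m & 1 < `|m|.

Definition elementary_stable (R : realType) (n : nat)
    (f : 'rV[R]_n -> 'rV[R]_n) (F : R -> 'rV[R]_n -> 'rV[R]_n) : Prop :=
  forall h : R, 0 < h -> forall y : 'rV[R]_n, equilibria f y ->
  [/\ F h y = y,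
      ode_stable f y -> map_stable (F h) y &
      ode_unstable f y -> map_unstable (F h) y].

(* Main.v *)
Require Import Defs.
From HB Require Import structures.
From mathcomp Require Import all_boot all_order all_algebra.
From mathcomp Require Import complex.
From mathcomp Require Import all_classical all_reals all_analysis.
From mathcomp Require Import ring lra.

Set Implicit Arguments.
Unset Strict Implicit.
Unset Printing Implicit Defensive.

Import Order.TTheory GRing.Theory Num.Theory.
Import numFieldNormedType.Exports.

Local Open Scope classical_set_scope.
Local Open Scope ring_scope.
Local Open Scope complex_scope.

(** At an equilibrium every stage vanishes, so the equilibrium is fixed, and
the chain rule turns the recurrence of the stages into the same recurrence for
their differentials.  Hence the Jacobian of one step is [P(e J)], where [J] is
the Jacobian of the field, [e] the value of the denominator function and [P]
the stability polynomial, which depends on the tableau only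
([jacobian_enrk]).  By the spectral mapping theorem the multipliers of the
step are the numbers [P(e l)] with [l] in the spectrum of [J]
([spectrum_enrk]).

The constant coefficient of [P] is 1 and the coefficient of degree 1 is the
sum of the weights.  A method of order at least 1 integrates the constant
field with error O(h^2), and this forces the weights to sum to 1
([order_sum_weights]).  So [P(z) = 1 + z + O(z^2)], and for small positive [e]
the modulus of [P(e l)] is [1 + e Re l + O(e^2)]: it lies on the side of 1
given by the sign of [Re l] ([near_tangent_exp_norm]).

Each [l] thus comes with its own threshold on [e].  Finitely many equilibria
have finitely many eigenvalues altogether, so the least of these thresholds is
positive, and it depends on nothing but the tableau and the spectrum. *)

Local Notation normc := ComplexField.Normc.normc.

(** * Polynomials tangent to the exponential *)

Lemma poly_tangent_exp (F : comNzRingType) (p : {poly F}) :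
  p`_0 = 1 -> p`_1 = 1 ->
  exists q : {poly F}, forall z, p.[z] = 1 + z + q.[z] * z ^+ 2.
Proof.
move=> p0 p1; exists (drop_poly 2 p) => z.
rewrite -[in LHS](poly_take_drop 2 p) hornerD hornerM hornerXn; congr (_ + _).
by rewrite horner_poly big_ord_recl big_ord1 /= p0 p1 expr0 expr1 mulr1 mul1r.
Qed.

Lemma poly_normc_bound (R : realType) (q : {poly R[i]}) :
  exists2 M : R, 0 <= M & forall z, normc z <= 1 -> normc q.[z] <= M.
Proof.
have [ub qub] := poly_disk_bound q 1.
have ubE z : normc z <= 1 ->
    normc q.[z] <= complex.Re ub.
  move=> z1; have: `|q.[z]| <= ub.
    by apply: qub; rewrite normc_def lecR; case: z z1.
  by rewrite lecE => /andP[_]; case: q.[z].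
exists (complex.Re ub) => //.
apply: le_trans (ubE 0 _); last by rewrite ComplexField.Normc.normc0.
by case: q.[0] => x y; rewrite sqrtr_ge0.
Qed.

(** Write [z = e l] and [p.[z] = 1 + z + q.[z] z^2].  The real part of [z] is of
first order in [e], whereas [|z|^2] and the remainder are of second order; so
the sign of [Re l] decides on which side of 1 the modulus falls. *)
Lemma near_tangent_exp_norm (R : realType) (p : {poly R[i]}) (l : R[i]) :
  p`_0 = 1 -> p`_1 = 1 ->
  \forall e \near (0 : R)^'+,
    (complex.Re l < 0 -> `|p.[e%:C * l]| < 1) /\
    (0 < complex.Re l -> 1 < `|p.[e%:C * l]|).
Proof.
move=> p0 p1; have [q pE] := poly_tangent_exp p0 p1.
have [M M0 qM] := poly_normc_bound q.
case: l => x y /=.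
pose L2 := x ^+ 2 + y ^+ 2.
have L20 : 0 <= L2 by rewrite addr_ge0 ?sqr_ge0.
have c0 : 0 <= L2 * (2^-1 + M) by rewrite mulr_ge0 // addr_ge0.
(* The second-order terms of [|P(e l)|] are at most [e^2 L2 (1/2 + M)]: this
   threshold makes them smaller than [e |x|].  It is void when [x = 0]. *)
have small_near : \forall e \near (0 : R)^'+,
    x != 0 -> e * (L2 * (2^-1 + M)) < `|x|.
  near=> e => x0; have e0 : 0 < e by [].
  apply: le_lt_trans (_ : e * (L2 * (2^-1 + M) + 1) < _).
    by rewrite ler_pM2l // lerDl.
  rewrite -ltr_pdivlMr ?ltr_wpDl //.
  move: x0; near: e; have [->|x0] := eqVneq x 0; first exact: nearW.
  near=> e => _; near: e.
  by apply: nbhs_right_lt; rewrite divr_gt0 ?normr_gt0 ?ltr_wpDl.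
near=> e.
have e0 : 0 < e by [].
have eL : e * (1 + L2) <= 1.
  rewrite -ler_pdivlMr ?ltr_wpDr // mul1r; near: e.
  by apply: nbhs_right_le; rewrite invr_gt0 ltr_wpDr.
have e1 : e <= 1 by nra.
have small : x != 0 -> e * (L2 * (2^-1 + M)) < `|x| by near: e.
set z := e%:C * (x +i* y).
have zE : z = (e * x) +i* (e * y) by rewrite /z /real_complex_def /=; simpc.
(* [|z| <= 1]: the first threshold on [e] makes the bound [M] available. *)
have nz2 : (e * x) ^+ 2 + (e * y) ^+ 2 = e ^+ 2 * L2 by rewrite /L2; ring.
have sq0 : 0 <= e ^+ 2 * L2 by rewrite mulr_ge0 ?sqr_ge0.
have z1 : normc z <= 1.
  by rewrite zE /= nz2 -sqrtr1 ler_wsqrtr //; nra.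
have nrem : normc (q.[z] * z ^+ 2) <= e ^+ 2 * L2 * M.
  rewrite (ComplexField.Normc.normcM q.[z]) expr2.
  rewrite (ComplexField.Normc.normcM z z) mulrC.
  have -> : normc z * normc z = e ^+ 2 * L2.
    by rewrite -expr2 zE /= sqr_sqrtr nz2 // mulr_ge0 ?sqr_ge0.
  by rewrite ler_wpM2l ?qM // mulr_ge0 ?sqr_ge0.
have -> : `|p.[z]| = (normc p.[z])%:C by [].
rewrite !ltcR; split=> xs.
- have {}small := small (ltr0_neq0 xs); rewrite ltr0_norm // in small.
  rewrite pE; apply: le_lt_trans (le_normcD _ _) _.
  have ex1 : -1 <= e * x by rewrite /L2 in eL *; nra.
  (* [|1 + z|^2 = 1 + 2 e x + e^2 L2], and the square of the right-hand side
     exceeds it by the square of [e x + e^2 L2 / 2]. *)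
  have h1 : normc (1 + z) <= 1 + e * x + e ^+ 2 * L2 / 2.
    rewrite zE /=; simpc.
    rewrite -[leRHS]ger0_norm; last by nra.
    rewrite -sqrtr_sqr ler_wsqrtr // -subr_ge0.
    have -> : (1 + e * x + e ^+ 2 * L2 / 2) ^+ 2
        - ((1 + e * x) ^+ 2 + (e * y) ^+ 2) = (e * x + e ^+ 2 * L2 / 2) ^+ 2.
      by rewrite -nz2; field.
    exact: sqr_ge0.
  nra.
- have {}small := small (lt0r_neq0 xs); rewrite gtr0_norm // in small.
  have h1 : 1 + e * x <= normc (1 + z).
    rewrite zE /=; simpc.
    rewrite -[leLHS]ger0_norm; last by nra.
    by rewrite -sqrtr_sqr ler_wsqrtr // lerDl sqr_ge0.
  have h2 := le_normcD (p.[z]) (- (q.[z] * z ^+ 2)).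
  rewrite normcN {1}pE addrK in h2.
  nra.
Unshelve. all: by end_near. Qed.

(** * Eigenvalues of a polynomial in a matrix *)

(** Over a closed field [p - m] is a product of linear factors [X - z].  If
[p(B) - m] is singular then so is one of the factors [B - z], and this [z] is an
eigenvalue with [p(z) = m]. *)
Lemma spectral_mapping (F : closedFieldType) (n : nat) (B : 'M[F]_n.+1)
    (p : {poly F}) (m : F) :
  eigenvalue (horner_mx B p) m -> exists2 l, eigenvalue B l & m = p.[l].
Proof.
case/eigenvalueP => v vm v0.
have sing : ~~ (horner_mx B p - m%:M \in unitmx).
  apply/negP => u; move/eqP: v0; apply.
  by rewrite -[v](mulmxK u) mulmxBr vm mul_mx_scalar subrr mul0mx.
(* If [p] is the constant [m], any eigenvalue of [B] will do. *)
have [c0|c0] := eqVneq (p - m%:P) 0.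
  have: size (char_poly B) != 1%N by rewrite size_char_poly.
  move=> /closed_rootP[l rl]; exists l; first by rewrite eigenvalue_root_char.
  by move/eqP: c0; rewrite subr_eq0 => /eqP ->; rewrite hornerC.
have [s sE] := closed_field_poly_normal (p - m%:P).
have hE : horner_mx B p - m%:M =
    lead_coef (p - m%:P) *: \prod_(z <- s) (B - z%:M).
  rewrite -(horner_mx_C B m) -rmorphB /= [X in horner_mx B X]sE.
  rewrite horner_mxZ rmorph_prod /=.
  congr (_ *: _); apply: eq_bigr => z _.
  by rewrite rmorphB /= horner_mx_X horner_mx_C.
have [l ls lB] : exists2 l, l \in s & ~~ (B - l%:M \in unitmx).
  apply/hasP; apply: contraNT sing => /hasPn all_unit.
  rewrite hE unitmxZ ?unitfE ?lead_coef_eq0 //.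
  rewrite big_seq; elim/big_ind: _ => [|x y ux uy|z zs]; first exact: unitmx1.
    by rewrite unitmx_mul ux.
  by move: (all_unit z zs); rewrite negbK.
exists l.
  by rewrite /eigenvalue /eigenspace kermx_eq0 row_free_unit.
have : root (p - m%:P) l.
  by rewrite sE rootZ ?lead_coef_eq0 // root_prod_XsubC.
by rewrite rootE hornerD hornerN hornerC subr_eq0 => /eqP.
Qed.

Lemma eigenvalue_horner_mx (F : fieldType) (n : nat) (B : 'M[F]_n.+1)
    (p : {poly F}) (l : F) :
  eigenvalue B l -> eigenvalue (horner_mx B p) p.[l].
Proof.
case/eigenvalueP => v vB v0; apply/eigenvalueP; exists v => //.
elim/poly_ind: p => [|p c IH]; first by rewrite rmorph0 horner0 mulmx0 scale0r.
rewrite rmorphD rmorphM /= horner_mx_X horner_mx_C mulmxDr mul_mx_scalar.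
by rewrite mulmxA IH -scalemxAl vB !hornerE scalerDl scalerA.
Qed.

Lemma eigenvalue_scale (F : fieldType) (n : nat) (B : 'M[F]_n) (e l : F) :
  e != 0 -> eigenvalue (e *: B) (e * l) = eigenvalue B l.
Proof.
move=> e0; apply/eigenvalueP/eigenvalueP => -[v vB v0]; exists v => //.
  by apply: (scalerI e0); rewrite scalemxAr vB scalerA.
by rewrite -scalemxAr vB scalerA.
Qed.

(** * The stability polynomial *)

(** At an equilibrium with Jacobian [J], the differential of [e K_i] is this
polynomial evaluated at [e J]; [m] is the unfolding depth of
[rk_stage_iter].  Scaling the stage by [e] makes the polynomial independent of
[e]. *)
Fixpoint stage_poly_iter (R : realType) (s : nat) (A : 'M[R]_s) (m : nat)
    (i : 'I_s) : {poly R} :=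
  if m is m'.+1 then
    'X * (1 + \sum_(j < s | (j < i)%N) A i j *: stage_poly_iter A m' j)
  else 0.

Definition stability_poly (R : realType) (s : nat) (A : 'M[R]_s)
    (b : 'rV[R]_s) : {poly R} :=
  1 + \sum_(i < s) b 0 i *: stage_poly_iter A i.+1 i.

Lemma stage_poly_iter0 (R : realType) (s : nat) (A : 'M[R]_s) (m : nat)
    (i : 'I_s) : (stage_poly_iter A m i)`_0 = 0.
Proof. by case: m => [|m] /=; rewrite ?coef0 // coefXM. Qed.

Lemma stage_poly_iter1 (R : realType) (s : nat) (A : 'M[R]_s) (m : nat)
    (i : 'I_s) : (stage_poly_iter A m.+1 i)`_1 = 1.
Proof.
rewrite /= coefXM /= coefD coef1 coef_sum big1 ?addr0 // => j _.
by rewrite coefZ stage_poly_iter0 mulr0.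
Qed.

Lemma stability_poly0 (R : realType) (s : nat) (A : 'M[R]_s) (b : 'rV[R]_s) :
  (stability_poly A b)`_0 = 1.
Proof.
rewrite coefD coef1 coef_sum big1 ?addr0 // => i _.
by rewrite coefZ stage_poly_iter0 mulr0.
Qed.

Lemma stability_poly1 (R : realType) (s : nat) (A : 'M[R]_s) (b : 'rV[R]_s) :
  (stability_poly A b)`_1 = \sum_(i < s) b 0 i.
Proof.
rewrite coefD coef1 add0r coef_sum; apply: eq_bigr => i _.
by rewrite coefZ stage_poly_iter1 mulr1.
Qed.

Local Notation stability_polyC A b :=
  (map_poly (real_complex _) (stability_poly A b)).

(** * Consistency *)

Lemma Ck_cst (R : realType) (n N : nat) (c : 'rV[R]_n) :
  Ck N (cst c : 'rV[R]_n -> 'rV[R]_n).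
Proof.
elim: N c => [|N IH] c /=; first exact: cst_continuous.
split=> [x|v]; first exact: differentiable_cst.
rewrite (_ : 'D_v (cst c) = cst 0); first exact: IH.
by apply/funext => x; rewrite derive_cst.
Qed.

(** Test on the scalar field 1, whose solution is [t]: all stages equal 1, so
one step makes the error [h (1 - sum_i b_i)], which is O(h^2) only if the
weights sum to 1. *)
Lemma order_sum_weights (R : realType) (s : nat) (A : 'M[R]_s) (b : 'rV[R]_s)
    (p : nat) :
  (1 <= p)%N -> order_at_least A b p -> \sum_(i < s) b 0 i = 1.
Proof.
move=> p1 [N ordN].
pose u : 'rV[R]_1 := const_mx 1.
have sol : ode_solution (cst u) 1 (fun t : R => t *: u).
  move=> t _; apply: DeriveDef; first exact/diff_derivable/ex_diff.
  by rewrite deriveE // diff_val scale1r.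
have u0 : 0 < `|u|.
  rewrite normr_gt0; apply/eqP => /matrixP/(_ 0 0); rewrite !mxE.
  exact/eqP/oner_neq0.
have := ordN 1%N (cst u) (Ck_cst N u) 1 _ ltr01 sol.
move/eqO_exP => [k k0 near_le].
have esrkE h : h *: u - esrk A b (cst u) h (0 *: u)
    = (h * (1 - \sum_(i < s) b 0 i)) *: u.
  rewrite /esrk /enrk /= scale0r add0r mulrBr mulr1 scalerBl -scalerA.
  by rewrite scaler_suml.
apply/eqP; rewrite eq_sym -subr_eq0 -normr_le0; apply/ler_addgt0Pl => eps eps0.
rewrite addr0.
near ((0 : R)^'+) => h.
have h0 : 0 < h by [].
have h1 : h <= 1 by near: h; apply: nbhs_right_le.
have kh : k * h <= eps * `|u|.
  rewrite -ler_pdivlMl // mulrC; near: h; apply: nbhs_right_le.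
  by rewrite divr_gt0 ?mulr_gt0.
have : `|h *: u - esrk A b (cst u) h (0 *: u)| <= k * `|h ^+ p.+1| by near: h.
rewrite esrkE normrZ normrM (gtr0_norm h0).
rewrite [`|h ^+ _|]ger0_norm ?exprn_ge0 ?(ltW h0) //.
rewrite exprS -mulrA [k * _]mulrCA ler_pM2l //.
move=> le_kh; rewrite -(ler_pM2r u0).
apply: le_trans le_kh (le_trans _ kh).
by rewrite ler_pM2l // -[leRHS]expr1 ler_wiXn2l // ltW.
Unshelve. all: by end_near. Qed.

(** * The linearised step at an equilibrium *)

Lemma is_diff_sum (R : numFieldType) (V W : normedModType R) (I : Type)
    (r : seq I) (P : pred I) (g dg : I -> V -> W) (x : V) :
  (forall i, P i -> is_diff x (g i) (dg i)) ->
  is_diff x (fun z => \sum_(i <- r | P i) g i z)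
    (fun v => \sum_(i <- r | P i) dg i v).
Proof.
move=> gd.
have -> : (fun z => \sum_(i <- r | P i) g i z) = \sum_(i <- r | P i) g i.
  by apply/funext => z; rewrite fct_sumE.
have -> : (fun z => \sum_(i <- r | P i) dg i z) = \sum_(i <- r | P i) dg i.
  by apply/funext => z; rewrite fct_sumE.
elim/big_rec2: _ => [|i g1 g2 Pi IH]; first exact: is_diff_cst.
by apply: is_diffD => //; exact: gd.
Qed.

Lemma is_diff_jacobian (R : realType) (n m : nat) (f : 'rV[R]_n -> 'rV[R]_m)
    (y : 'rV[R]_n) :
  differentiable f y -> is_diff y f (fun v => v *m jacobian f y).
Proof.
by move=> df; apply: DiffDef => //; apply/funext => v; rewrite mul_rV_lin1.
Qed.

Lemma rk_stage_iter_equilibrium (R : realType) (n s : nat) (A : 'M[R]_s)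
    (f : 'rV[R]_n -> 'rV[R]_n) (e : R) (y : 'rV[R]_n) (m : nat) (i : 'I_s) :
  f y = 0 -> rk_stage_iter A f e y m i = 0.
Proof.
move=> fy; elim: m i => [//|m IH] i /=.
by rewrite big1 ?scaler0 ?addr0 // => j _; rewrite IH scaler0.
Qed.

(** By induction on the depth: [e K_i] is [e f] after the map
[G z = z + sum_j a_ij (e K_j z)], which fixes the equilibrium, so the chain rule
only involves [J] there.  Dimension 0 is excluded because square matrices of
size 0 have no ring structure to evaluate a polynomial in. *)
Lemma is_diff_stage (R : realType) (n s : nat) (A : 'M[R]_s)
    (f : 'rV[R]_n.+1 -> 'rV[R]_n.+1) (e : R) (y : 'rV[R]_n.+1) (m : nat)
    (i : 'I_s) :
  f y = 0 -> differentiable f y ->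
  is_diff y (fun z => e *: rk_stage_iter A f e z m i)
    (fun v => v *m horner_mx (e *: jacobian f y) (stage_poly_iter A m i)).
Proof.
move=> fy df; elim: m i => [|m IH] i /=.
  rewrite scaler0.
  have -> : (fun v => v *m horner_mx (e *: jacobian f y) 0) = cst 0
      :> ('rV[R]_n.+1 -> 'rV[R]_n.+1).
    by apply/funext => v; rewrite rmorph0 mulmx0.
  exact: is_diff_cst.
set J := jacobian f y.
pose G : 'rV[R]_n.+1 -> 'rV[R]_n.+1 :=
  id + (fun z => \sum_(j < s | (j < i)%N)
    A i j *: (e *: rk_stage_iter A f e z m j)).
have dG : is_diff y G
    (id + (fun v => \sum_(j < s | (j < i)%N)
        A i j *: (v *m horner_mx (e *: J) (stage_poly_iter A m j)))).
  apply: is_diffD.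
  apply: is_diff_sum => j _; exact: (is_diffZ (A i j) (IH j)).
have Gy : G y = y.
  rewrite /G /= !fctE big1 ?addr0 // => j _.
  by rewrite rk_stage_iter_equilibrium // !scaler0.
have dfG : is_diff (G y) f (fun v => v *m J).
  by rewrite Gy; exact: is_diff_jacobian.
have := is_diffZ e (is_diff_comp dG dfG).
congr is_diff_def; apply/funext => v.
  rewrite !fctE /=; congr (_ *: f (_ + _)).
  by rewrite scaler_sumr; apply: eq_bigr => j _; rewrite !scalerA mulrC.
rewrite !fctE /= mulrC rmorphM rmorphD rmorph1 rmorph_sum /= horner_mx_X.
rewrite mulmxA -scalemxAr; congr (_ *: (_ *m _)).
rewrite mulmxDr mulmx1 mulmx_sumr; congr (_ + _); apply: eq_bigr => j _.
by rewrite linearZ /= scalemxAr.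
Qed.

Lemma enrk_equilibrium (R : realType) (n s : nat) (A : 'M[R]_s) (b : 'rV[R]_s)
    (phi : R -> R) (f : 'rV[R]_n -> 'rV[R]_n) (h : R) (y : 'rV[R]_n) :
  f y = 0 -> enrk A b phi f h y = y.
Proof.
move=> fy; rewrite /enrk big1 ?scaler0 ?addr0 // => i _.
by rewrite /rk_stage rk_stage_iter_equilibrium // scaler0.
Qed.

Lemma jacobian_enrk (R : realType) (n s : nat) (A : 'M[R]_s) (b : 'rV[R]_s)
    (phi : R -> R) (f : 'rV[R]_n.+1 -> 'rV[R]_n.+1) (h : R) (y : 'rV[R]_n.+1) :
  f y = 0 -> differentiable f y ->
  jacobian (enrk A b phi f h) y =
    horner_mx (phi h *: jacobian f y) (stability_poly A b).
Proof.
move=> fy df; set e := phi h; set J := jacobian f y.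
have dF : is_diff y
    (id + (fun z => \sum_(i < s) b 0 i *: (e *: rk_stage A f e z i)))
    (id + (fun v => \sum_(i < s)
        b 0 i *: (v *m horner_mx (e *: J) (stage_poly_iter A i.+1 i)))).
  apply: is_diffD; apply: is_diff_sum => i _.
  exact: (is_diffZ (b 0 i) (is_diff_stage A e i.+1 i fy df)).
have FE : enrk A b phi f h =
    id + (fun z => \sum_(i < s) b 0 i *: (e *: rk_stage A f e z i)).
  apply/funext => z; rewrite /enrk !fctE /=; congr (_ + _).
  by rewrite scaler_sumr; apply: eq_bigr => i _; rewrite !scalerA mulrC.
apply/row_matrixP => i; rewrite !rowE /jacobian FE mul_rV_lin1 /= diff_val.
rewrite !fctE /= rmorphD rmorph1 rmorph_sum /= mulmxDr mulmx1 mulmx_sumr.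
congr (_ + _); apply: eq_bigr => j _.
by rewrite linearZ /= scalemxAr.
Qed.

Lemma spectrum_enrk (R : realType) (n s : nat) (A : 'M[R]_s) (b : 'rV[R]_s)
    (phi : R -> R) (f : 'rV[R]_n -> 'rV[R]_n) (h : R) (y : 'rV[R]_n) :
  f y = 0 -> differentiable f y -> phi h != 0 ->
  spectrum (enrk A b phi f h) y =
  (fun l => (stability_polyC A b).[(phi h)%:C * l])
    @` spectrum f y.
Proof.
case: n f y => [|n] f y fy df e0.
  have no_eig (B : 'M[R[i]]_0) l : ~ eigenvalue B l.
    by case/eigenvalueP => v _; rewrite [v]thinmx0 eqxx.
  by apply/seteqP; split=> [m /no_eig //|m [l /no_eig]].
have eC0 : (phi h)%:C != 0 :> R[i] by rewrite eq_complex /= eqxx andbT.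
have jacE : map_mx (real_complex R) (jacobian (enrk A b phi f h) y) =
    horner_mx ((phi h)%:C *: map_mx (real_complex R) (jacobian f y))
      (stability_polyC A b).
  by rewrite jacobian_enrk // map_horner_mx map_mxZ.
have specE : spectrum (enrk A b phi f h) y = [set m | eigenvalue
    (horner_mx ((phi h)%:C *: map_mx (real_complex R) (jacobian f y))
      (stability_polyC A b)) m].
  exact: (congr1 (fun B : 'M[R[i]]_n.+1 => [set m | eigenvalue B m]) jacE).
rewrite specE; set JC := map_mx _ _.
apply/seteqP; split=> [m eig_m|_ [l eig_l <-]].
  have [l eig_l ->] := spectral_mapping eig_m.
  exists ((phi h)%:C^-1 * l); last by rewrite mulVKf.
  suff: eigenvalue JC ((phi h)%:C^-1 * l) by [].
  by rewrite -(eigenvalue_scale JC _ eC0) mulVKf.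
apply: eigenvalue_horner_mx.
by rewrite (eigenvalue_scale JC l eC0).
Qed.

(** * Elementary stability *)

Lemma finite_spectrum (R : realType) (n : nat) (F : 'rV[R]_n -> 'rV[R]_n)
    (y : 'rV[R]_n) : finite_set (spectrum F y).
Proof.
set B := map_mx (real_complex R) (jacobian F y).
have [r rE] := closed_field_poly_normal (char_poly B).
apply: (@sub_finite_set _ _ [set` r]); last by apply/finite_seqP; exists r.
move=> l; rewrite /spectrum /= -/B eigenvalue_root_char rE.
by rewrite (monicP (char_poly_monic B)) scale1r root_prod_XsubC.
Qed.

Lemma near_finite_set (U T : Type) (F : set_system U) (D : set T)
    (P : T -> U -> Prop) :
  Filter F -> finite_set D -> (forall t, \forall e \near F, P t e) ->
  \forall e \near F, forall t, D t -> P t e.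
Proof.
elim/Pchoice: T => T in D P *.
move=> FF /finite_fsetP[X ->] nearP.
exact: (@filter_bigI _ _ X P F FF (fun t _ => nearP t)).
Qed.

Theorem theorem2 (R : realType) (s : nat) (A : 'M[R]_s) (b : 'rV[R]_s)
    (p : nat) (Omega : set R[i]) :
  (1 <= s)%N -> explicit_tableau A ->
  order_of_accuracy A b p -> (1 <= p)%N -> (p < s)%N ->
  exists phistar : R, 0 < phistar /\
    forall (n : nat) (f : 'rV[R]_n -> 'rV[R]_n),
      (forall x : 'rV[R]_n, differentiable f x) ->
      finite_set (equilibria f) ->
      equilibria_spectrum f = Omega ->
      (forall l : R[i], Omega l -> complex.Re l != 0) ->
      forall phi : R -> R, denominator_function phi ->
        (forall h : R, 0 < h -> 0 < phi h < phistar) ->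
        elementary_stable f (enrk A b phi f).
Proof.
move=> _ _ [ord_p _] p1 _.
pose S := stability_polyC A b.
have S0 : S`_0 = 1 by rewrite coef_map stability_poly0.
have S1 : S`_1 = 1.
  by rewrite coef_map stability_poly1 (order_sum_weights p1 ord_p).
(* No field with finitely many equilibria has an infinite spectrum, so in that
   case any threshold will do. *)
have [finOmega|infOmega] := pselect (finite_set Omega); last first.
  exists 1; split=> [|n f _ finE specE]; first exact: ltr01.
  case: infOmega; rewrite -specE.
  by apply: bigcup_finite => [|y _]; [exact: finE|exact: finite_spectrum].
have [d /= d0 dP] :=
  near_finite_set _ finOmega (fun l => near_tangent_exp_norm l S0 S1).
exists d; split=> [//|n f df _ specE _ phi _ phi_small h h0 y fy].
have /andP[e0 ed] := phi_small h h0.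
have eigP l : spectrum f y l ->
    (complex.Re l < 0 -> `|S.[(phi h)%:C * l]| < 1) /\
    (0 < complex.Re l -> 1 < `|S.[(phi h)%:C * l]|).
  move=> fl; apply: dP => //; first by rewrite /= sub0r normrN gtr0_norm.
  by rewrite -specE; exists y.
have specF := spectrum_enrk A b fy (df y) (lt0r_neq0 e0).
split; first exact: enrk_equilibrium.
- move=> stab m; rewrite specF => -[l fl <-].
  by apply: (eigP l fl).1; exact: stab.
- case=> l fl l0; exists S.[(phi h)%:C * l]; last exact: (eigP l fl).2.
  by rewrite specF; exists l.
Qed.
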